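(* Let $-1<g<1$, $-1\le\lambda\le1$, and define $$F_{g,\lambda}(z)=z\frac{g+\lambda z}{1+g\lambda z}.$$ Then $F_{g,\lambda}$ is a Schur function with $F_{g,\lambda}(0)=0$, and $$\mathcal R(F_{g,\lambda})\ge0.$$ Equality holds only at $g=\lambda=0$, where $F_{g,\lambda}=0$. Thus every nonzero member of this two-real-parameter family has $\mathcal R(F_{g,\lambda})>0$.
   Context: A Schur function is an analytic function $F$ on the open unit disk $\mathbb D$ with $|F|\le1$. For $F$ analytic in a neighborhood of $\overline{\mathbb D}$, put $G(z)=zF'(z)$ and define $$\mathcal R(F)=\left.\frac1{4\pi}\int_0^{2\pi}\bigl(1-\mathrm{Re}\,F(re^{i\theta})\bigr)\,\partial_r\bigl|G(re^{i\theta})\bigr|^2\,d\theta\right|_{r=1}.$$ *)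

(* Defs.v *)
From Stdlib Require Import Reals.
From Coquelicot Require Import Coquelicot.

Local Open Scope R_scope.

Definition analytic_at (F : C -> C) (z0 : C) : Prop :=
  exists (a : nat -> C) (rho : posreal),
    forall z : C, Cmod (z - z0)%C < rho ->
      @is_pseries C_AbsRing C_NormedModule a (z - z0)%C (F z).

Definition analytic_on (U : C -> Prop) (F : C -> C) : Prop :=
  forall z : C, U z -> analytic_at F z.

Definition schur (F : C -> C) : Prop :=
  analytic_on (fun z => Cmod z < 1) F /\
  forall z : C, Cmod z < 1 -> Cmod (F z) <= 1.

Definition analytic_near_closed_disk (F : C -> C) : Prop :=
  exists U : C -> Prop,
    open U /\ (forall z : C, Cmod z <= 1 -> U z) /\ analytic_on U F.

Definition polar (r theta : R) : C := (r * cos theta, r * sin theta).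

(* [C_derive] is Coquelicot's limit of difference quotients along the real
   direction; it is F'(z) wherever [F] is complex differentiable. *)
Definition zderiv (F : C -> C) (z : C) : C := (z * C_derive F z)%C.

Definition Rfun_at (F : C -> C) (r : R) : R :=
  / (4 * PI) *
  RInt (fun theta : R =>
          (1 - Re (F (polar r theta))) *
          Derive (fun s : R => Cmod (zderiv F (polar s theta)) ^ 2) r)
       0 (2 * PI).

(* [C_derive], [Derive] and [RInt] are total, so this is the intended quantity
   only for [F] satisfying [analytic_near_closed_disk]. *)
Definition Rfun (F : C -> C) : R := Rfun_at F 1.

(* For |g| < 1 and |lam| <= 1 the only pole -1/(g lam), if any, lies outside the
   closed unit disk. *)
Definition Fgl (g lam : R) (z : C) : C :=
  (z * ((RtoC g + RtoC lam * z) / (RtoC 1 + RtoC g * RtoC lam * z)))%C.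

(* Main.v *)
Require Import Defs.
From Stdlib Require Import Reals Lra Psatz.
From Coquelicot Require Import Coquelicot.

Local Open Scope R_scope.

(** Put [c = g lam], [u = g^2], [t = c^2], [w = 1 - t], [d = 1 - u] and [y = lam d].

    The functional can be evaluated in closed form.  On the unit circle let
    [x = cos theta] and [D = |1 + c z|^2 = 1 + 2 c x + c^2].  Both [1 - Re F] and
    the radial derivative of [|G|^2] are rational in [x] with a power of [D] as
    denominator, and the integrand is a quintic in [x] over [D^4].  As [x] is an
    affine function of [D] when [c <> 0], this quintic is a polynomial in [D], so
    that only the integrals of [D^k] for [-4 <= k <= 1] are needed.  The one of
    [1/D] is the Poisson integral; the others follow from a three-term recursion
    ([pden_moment_step]), because the derivative of [sin theta / D^k] integrates
    to zero over a period.  When [c = 0] the integrand is a quadratic in [x].  The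
    result ([Rfun_Fgl]) is

      [R(F) = u (1 - 3 y) + y^2 (w (A + lam u K) - t d lam E) / w^5],

    where [A], [K], [E] are cubics in [w] with nonnegative coefficients.

    Positivity of this expression splits according to the sign of [lam].
    For [lam >= 0] the bracket is at least [w B] with [B > (9/4) w^4], and
    [u (1 - 3 y) + (9/4) u y^2 = u (1 - (3/2) y)^2] ([Rclosed_pos_nneg]).
    For [lam = - l < 0], [w^5 R(F)] equals, with [m = |g| l],

      [u w^5 (1 + 3 l d) + l d^2 w (l A - m^2 K) + l^3 m^2 d^3 E],

    whose only possibly negative summand is the middle one.  A concavity argument
    in [l] on [[m, 1]] shows [l A - m^2 K >= - 8 m^2 l (1 - l)]
    ([concave_lower_bound]); since [1 - l <= w], the whole sum is then at least
    [u (w^5 + 10 X^3 - 8 w^2 X^2)] with [X = l^2 d], and this is positive for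
    [u > 0] because [0 < w <= 1] ([Rclosed_pos_neg]).

    The Schur bound is [|1 + c z|^2 - |g + lam z|^2 = (1 - g^2)(1 - lam^2 |z|^2)],
    and analyticity comes from expanding [1 / (1 + c z)] in a geometric series. *)

(** * Analyticity and the Schur bound *)

Lemma C_pow_n (z : C) (n : nat) : @pow_n C_AbsRing z n = (z ^ n)%C.
Proof. induction n as [|n IH]; [reflexivity|]. simpl. rewrite IH. reflexivity. Qed.

Lemma sum_n_geom_C (q : C) (n : nat) : q <> 1%C ->
  @sum_n C_AbelianMonoid (fun k => (q ^ k)%C) n = ((1 - q ^ S n) / (1 - q))%C.
Proof.
intros hq.
assert (h : (1 - q)%C <> 0%C).
{ intros h. apply hq. replace q with (1 - (1 - q))%C by ring. rewrite h. ring. }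
induction n as [|n IH].
- rewrite sum_O. simpl. match goal with |- ?a = ?b => change (@eq C a b) end.
  field. exact h.
- rewrite sum_Sn, IH. change plus with Cplus. rewrite !Cpow_S.
  match goal with |- ?a = ?b => change (@eq C a b) end. field. exact h.
Qed.

Lemma is_series_geom_C (q : C) : Cmod q < 1 ->
  @is_series C_AbsRing C_NormedModule (fun k => (q ^ k)%C) (/ (1 - q))%C.
Proof.
intros hq.
assert (hq1 : q <> 1%C) by (intros ->; rewrite Cmod_1 in hq; lra).
assert (h : (1 - q)%C <> 0%C).
{ intros h. apply hq1. replace q with (1 - (1 - q))%C by ring. rewrite h. ring. }
assert (hp : 0 < Cmod (1 - q)) by (apply Cmod_gt_0; exact h).
unfold is_series. apply filterlim_locally_ball_norm. intros eps.
pose proof (is_lim_seq_geom (Cmod q)) as hg.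
rewrite Rabs_pos_eq in hg by apply Cmod_ge_0. specialize (hg hq).
apply is_lim_seq_spec in hg.
assert (he : 0 < eps * Cmod (1 - q)) by (apply Rmult_lt_0_compat; [apply cond_pos | exact hp]).
destruct (hg (mkposreal _ he)) as [N hN].
exists N. intros n hn. specialize (hN (S n) (le_S _ _ hn)). simpl pos in hN.
unfold ball_norm.
change (Cmod (sum_n (G := C_AbelianMonoid) (fun k : nat => (q ^ k)%C) n - / (1 - q))%C < eps).
rewrite sum_n_geom_C by exact hq1.
replace ((1 - q ^ S n) / (1 - q) - / (1 - q))%C with (- (q ^ S n / (1 - q)))%C by (field; exact h).
rewrite Cmod_opp, Cmod_div, Cmod_pow by exact h.
rewrite Rminus_0_r, Rabs_pos_eq in hN by (apply pow_le, Cmod_ge_0).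
apply (Rmult_lt_reg_r (Cmod (1 - q))); [exact hp|].
replace (Cmod q ^ S n / Cmod (1 - q) * Cmod (1 - q)) with (Cmod q ^ S n) by (field; lra).
exact hN.
Qed.

(** With [h = z - z0] and [w0 = 1 + c z0], the function is a quadratic in [h] times
    [1 / (w0 + c h)].  The latter is a geometric series in [h], and multiplying by
    [h] shifts its coefficients. *)
Lemma analytic_at_quotient (p q c : C) (z0 : C) : (1 + c * z0)%C <> 0%C ->
  analytic_at (fun z => (z * ((p + q * z) / (1 + c * z)))%C) z0.
Proof.
intros hz0. set (w0 := (1 + c * z0)%C) in *.
assert (hw0 : 0 < Cmod w0) by (apply Cmod_gt_0; exact hz0).
pose proof (Cmod_ge_0 c) as hc0.
(* This radius forces [|c h| < |w0|], and is meaningful also when [c = 0]. *)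
assert (hrho : 0 < Cmod w0 / (1 + Cmod c)) by (apply Rdiv_lt_0_compat; lra).
set (e := fun k : nat => (/ w0 * (- c / w0) ^ k)%C : C_NormedModule).
set (b := fun s : C => @PS_scal C_AbsRing C_NormedModule s e).
exists (PS_plus (b (z0 * (p + q * z0))%C)
  (PS_incr_1 (PS_plus (b (p + 2 * q * z0)%C) (PS_incr_1 (b q))))).
exists (mkposreal _ hrho). simpl pos. intros z hz.
set (h := (z - z0)%C) in *.
assert (hch : Cmod (- c / w0 * h) < 1).
{ rewrite Cmod_mult, Cmod_div, Cmod_opp by exact hz0.
  apply (Rmult_lt_reg_r (Cmod w0)); [exact hw0|].
  replace (Cmod c / Cmod w0 * Cmod h * Cmod w0) with (Cmod c * Cmod h) by (field; lra).
  assert (hm : Cmod h * (1 + Cmod c) < Cmod w0).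
  { apply (Rmult_lt_reg_r (/ (1 + Cmod c))); [apply Rinv_0_lt_compat; lra|].
    rewrite Rmult_assoc, Rinv_r, Rmult_1_r by lra. exact hz. }
  pose proof (Cmod_ge_0 h). nra. }
assert (hw : (1 + c * z)%C <> 0%C).
{ intros h0.
  assert (h1 : (- c / w0 * h)%C = 1%C).
  { replace (- c / w0 * h)%C with (1 - (1 + c * z) / w0)%C by (unfold h, w0; field; exact hz0).
    rewrite h0. field. exact hz0. }
  rewrite h1, Cmod_1 in hch. lra. }
assert (hw' : (w0 + c * h)%C <> 0%C).
{ replace (w0 + c * h)%C with (1 + c * z)%C by (unfold w0, h; ring). exact hw. }
assert (he : @is_pseries C_AbsRing C_NormedModule e h (/ (1 + c * z))%C).
{ unfold is_pseries.
  replace (/ (1 + c * z))%C with (scal (V := C_NormedModule) (/ w0)%C (/ (1 - (- c / w0 * h)))%C).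
  - eapply is_series_ext; [|apply is_series_scal_l, is_series_geom_C, hch].
    intros n. unfold e. change (@scal C_AbsRing C_NormedModule) with Cmult.
    rewrite Cpow_mult_l. rewrite (C_pow_n h n).
    match goal with |- ?a = ?b => change (@eq C a b) end. ring.
  - change (@scal C_AbsRing C_NormedModule) with Cmult.
    match goal with |- ?a = ?b => change (@eq C a b) end.
    replace (1 + c * z)%C with (w0 + c * h)%C by (unfold w0, h; ring).
    field. repeat split; assumption. }
set (v := (/ (1 + c * z))%C) in *.
assert (hb : forall s, @is_pseries C_AbsRing C_NormedModule (b s) h (s * v)%C).
{ intros s. exact (@is_pseries_scal C_AbsRing C_NormedModule s e h _ (Cmult_comm h s) he). }
pose proof (@is_pseries_incr_1 C_AbsRing C_NormedModule _ h _ (hb q)) as h2.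
pose proof (@is_pseries_plus C_AbsRing C_NormedModule _ _ h _ _ (hb (p + 2 * q * z0)%C) h2) as h1.
pose proof (@is_pseries_incr_1 C_AbsRing C_NormedModule _ h _ h1) as h1'.
pose proof (@is_pseries_plus C_AbsRing C_NormedModule _ _ h _ _ (hb (z0 * (p + q * z0))%C) h1') as h0.
replace (z * ((p + q * z) / (1 + c * z)))%C with
  (z0 * (p + q * z0) * v + h * ((p + 2 * q * z0) * v + h * (q * v)))%C
  by (unfold v, h; field; exact hw).
exact h0.
Qed.

Lemma denom_neq0 (c : R) (z : C) : Rabs c * Cmod z < 1 -> (1 + c * z)%C <> 0%C.
Proof.
intros h h0.
assert (h1 : (c * z)%C = (- (1))%C).
{ replace (c * z)%C with ((1 + c * z) - 1)%C by ring. rewrite h0. ring. }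
apply (f_equal Cmod) in h1. rewrite Cmod_mult, Cmod_R, Cmod_m1 in h1. lra.
Qed.

Lemma Fgl_analytic_at (g lam : R) (z : C) : Rabs (g * lam) * Cmod z < 1 ->
  analytic_at (Fgl g lam) z.
Proof.
intros h.
assert (h' : (1 + g * lam * z)%C <> 0%C).
{ rewrite <- RtoC_mult. apply denom_neq0, h. }
exact (analytic_at_quotient g lam (g * lam)%C z h').
Qed.

Lemma Rabs_glam (g lam : R) : -1 < g < 1 -> -1 <= lam <= 1 -> Rabs (g * lam) < 1.
Proof.
intros hg hl. rewrite Rabs_mult.
assert (Rabs g < 1) by (apply Rabs_def1; lra).
assert (Rabs lam <= 1) by (apply Rabs_le; lra).
pose proof (Rabs_pos g). pose proof (Rabs_pos lam). nra.
Qed.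

Lemma Fgl_near_disk (g lam : R) : -1 < g < 1 -> -1 <= lam <= 1 ->
  analytic_near_closed_disk (Fgl g lam).
Proof.
intros hg hl. pose proof (Rabs_glam g lam hg hl) as hc.
exists (fun z => Rabs (g * lam) * Cmod z < 1). split; [|split].
- apply (open_comp (fun z : C => Rabs (g * lam) * Cmod z) (fun x => x < 1)).
  + intros z _. apply (filterlim_comp _ _ _ Cmod (Rmult (Rabs (g * lam))) _ (locally (Cmod z))).
    * apply (@filterlim_norm C_AbsRing C_NormedModule z).
    * apply (filterlim_scal_r (K := R_AbsRing) (V := R_NormedModule)).
  + apply open_lt.
- intros z hz. pose proof (Rabs_pos (g * lam)). pose proof (Cmod_ge_0 z). nra.
- intros z hz. apply Fgl_analytic_at, hz.
Qed.

Lemma Fgl_schur (g lam : R) : -1 < g < 1 -> -1 <= lam <= 1 -> schur (Fgl g lam).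
Proof.
intros hg hl. pose proof (Rabs_glam g lam hg hl) as hc.
split.
- intros z hz. apply Fgl_analytic_at.
  pose proof (Rabs_pos (g * lam)). pose proof (Cmod_ge_0 z). nra.
- intros z hz.
  assert (hd : (1 + g * lam * z)%C <> 0%C).
  { rewrite <- RtoC_mult. apply denom_neq0.
    pose proof (Rabs_pos (g * lam)). pose proof (Cmod_ge_0 z). nra. }
  assert (hle : Cmod (g + lam * z)%C <= Cmod (1 + g * lam * z)%C).
  { apply Rsqr_incr_0_var; [|apply Cmod_ge_0]. rewrite !Rsqr_pow2, !Cmod2_alt.
    assert (hz2 : Cmod z ^ 2 <= 1) by (pose proof (Cmod_ge_0 z); nra).
    rewrite Cmod2_alt in hz2. destruct z as [x y]. simpl in *.
    assert (0 <= (1 - g ^ 2) * (1 - lam ^ 2 * (x ^ 2 + y ^ 2))).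
    { assert (0 <= lam ^ 2 <= 1) by nra.
      apply Rmult_le_pos; [nra|]. nra. }
    nra. }
  unfold Fgl. rewrite Cmod_mult, Cmod_div by exact hd.
  pose proof (Cmod_ge_0 z). apply Cmod_gt_0 in hd.
  assert (Cmod (g + lam * z)%C / Cmod (1 + g * lam * z)%C <= 1).
  { apply (Rmult_le_reg_r (Cmod (1 + g * lam * z)%C)); [exact hd|].
    unfold Rdiv. rewrite Rmult_assoc, Rinv_l, Rmult_1_r, Rmult_1_l by lra. exact hle. }
  assert (0 <= Cmod (g + lam * z)%C / Cmod (1 + g * lam * z)%C).
  { apply Rdiv_le_0_compat; [apply Cmod_ge_0 | exact hd]. }
  nra.
Qed.

(** * The complex derivative *)

(** Caratheodory's form of differentiability; [C_derive] only looks at real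
    increments, so the slope [K] need only be continuous along the horizontal line
    through [z]. *)
Lemma C_derive_caratheodory (f K : C -> C) (z : C) (eps : posreal) :
  (forall x : R, Rabs (x - fst z) < eps ->
     (f (x, snd z) - f z = ((x, snd z) - z) * K (x, snd z))%C) ->
  continuous (fun x : R => fst (K (x, snd z))) (fst z) ->
  continuous (fun x : R => snd (K (x, snd z))) (fst z) ->
  C_derive f z = K z.
Proof.
intros hK h1 h2.
assert (hq : forall p : C -> R,
  continuous (fun x : R => p (K (x, snd z))) (fst z) ->
  real (Lim (fun x : R => p ((f (x, snd z) - f z) / ((x, snd z) - z))%C) (fst z)) = p (K z)).
{ intros p hp. rewrite (is_lim_unique _ _ (Finite (p (K z)))); [reflexivity|].
  apply is_lim_ext_loc with (fun x : R => p (K (x, snd z))).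
  - exists eps. intros x hx hne.
    rewrite hK by exact hx. f_equal. field.
    intros h. apply hne. apply (f_equal fst) in h. destruct z; simpl in *. lra.
  - replace (K z) with (K (fst z, snd z)) by (destruct z; reflexivity).
    apply (is_lim_continuity (fun x : R => p (K (x, snd z)))).
    apply continuity_pt_filterlim, hp. }
unfold C_derive, C_lim. rewrite (hq fst h1), (hq snd h2).
symmetry; apply surjective_pairing.
Qed.

Lemma Fgl_C_derive (g lam : R) (z : C) : (1 + g * lam * z)%C <> 0%C ->
  C_derive (Fgl g lam) z =
   ((g + 2 * lam * z + g * lam * lam * z ^ 2) / (1 + g * lam * z) ^ 2)%C.
Proof.
intros hz.
assert (hp : 0 < Cmod (1 + g * lam * z)%C) by (apply Cmod_gt_0; exact hz).
pose proof (Rabs_pos (g * lam)) as hc.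
(* Within this distance of [z] along the real direction, [1 + g lam x] stays nonzero. *)
assert (he : 0 < Cmod (1 + g * lam * z)%C / (1 + Rabs (g * lam))) by (apply Rdiv_lt_0_compat; lra).
assert (hn : (1 + g * lam * fst z) * (1 + g * lam * fst z) + g * lam * snd z * (g * lam * snd z) <> 0).
{ intros h0. apply hz. destruct z as [x y]. unfold RtoC, Cplus, Cmult; simpl in *.
  assert (1 + g * lam * x = 0) by nra. assert (g * lam * y = 0) by nra.
  f_equal; lra. }
(* The slope is the difference quotient of F after cancelling [x - z]. *)
rewrite (C_derive_caratheodory _
  (fun x => ((g + lam * (x + z) + g * lam * lam * x * z) / (1 + g * lam * x) / (1 + g * lam * z))%C)
  z (mkposreal _ he)).
- field. exact hz.
- simpl pos. intros x hx.
  assert (hx0 : (1 + g * lam * (x, snd z))%C <> 0%C).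
  { intros h0.
    assert (h1 : (1 + g * lam * z)%C = (- (RtoC (g * lam) * RtoC (x - fst z)))%C).
    { replace (1 + g * lam * z)%C with ((1 + g * lam * z) - (1 + g * lam * (x, snd z)))%C
        by (rewrite h0; ring).
      rewrite RtoC_mult. destruct z as [a b]. simpl.
      unfold RtoC, Cminus, Cmult, Cplus, Copp; simpl. f_equal; ring. }
    apply (f_equal Cmod) in h1. rewrite Cmod_opp, Cmod_mult, !Cmod_R in h1.
    rewrite h1 in hx.
    apply (Rmult_lt_compat_r (1 + Rabs (g * lam))) in hx; [|lra].
    unfold Rdiv in hx. rewrite Rmult_assoc, Rinv_l, Rmult_1_r in hx by lra.
    pose proof (Rabs_pos (x - fst z)). nra. }
  unfold Fgl. field. split; assumption.
- apply (ex_derive_continuous (K := R_AbsRing) (V := R_NormedModule)). destruct z as [a b].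
  unfold RtoC, Cdiv, Cinv, Cminus, Cmult, Cplus, Copp. cbn [fst snd] in *.
  auto_derive. repeat split; try (simpl; intros h0; apply hn; nra).
- apply (ex_derive_continuous (K := R_AbsRing) (V := R_NormedModule)). destruct z as [a b].
  unfold RtoC, Cdiv, Cinv, Cminus, Cmult, Cplus, Copp. cbn [fst snd] in *.
  auto_derive. repeat split; try (simpl; intros h0; apply hn; nra).
Qed.

(** * Moments of the Poisson denominator *)

(** [|1 + c exp(i theta)|^2], the denominator of the Poisson kernel. *)
Definition pden (c theta : R) : R := 1 + 2 * c * cos theta + c ^ 2.

Lemma one_add_cos_pos (c theta : R) : -1 < c < 1 -> 0 < 1 + c * cos theta.
Proof. intros hc. pose proof (COS_bound theta). destruct (Rle_dec 0 c); nra. Qed.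

Lemma pden_pos (c theta : R) : -1 < c < 1 -> 0 < pden c theta.
Proof.
intros hc. unfold pden. pose proof (sin2_cos2 theta) as h. rewrite !Rsqr_pow2 in h.
pose proof (one_add_cos_pos c theta hc).
replace (1 + 2 * c * cos theta + c ^ 2) with ((1 + c * cos theta) ^ 2 + (c * sin theta) ^ 2).
- pose proof (pow2_ge_0 (c * sin theta)). nra.
- rewrite Rpow_mult_distr. replace (sin theta ^ 2) with (1 - cos theta ^ 2) by lra. ring.
Qed.

Lemma is_RInt_lincomb (f h : R -> R) (a b u v p q : R) :
  is_RInt f a b u -> is_RInt h a b v ->
  is_RInt (fun x => p * f x + q * h x) a b (p * u + q * v).
Proof.
intros hf hh.
exact (is_RInt_plus (V := R_NormedModule) _ _ _ _ _ _
  (is_RInt_scal (V := R_NormedModule) _ _ _ p _ hf) (is_RInt_scal (V := R_NormedModule) _ _ _ q _ hh)).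
Qed.

(** The Poisson integral.  The antiderivative is
    [(theta - 2 arg (1 + c exp(i theta))) / (1 - c^2)], where the argument is a
    single-valued arctangent because [1 + c cos theta > 0]. *)
Lemma pden_moment1 (c : R) : -1 < c < 1 ->
  is_RInt (fun theta => / pden c theta) 0 (2 * PI) (2 * PI * (/ (1 - c ^ 2))).
Proof.
intros hc.
set (A := fun theta => (theta - 2 * atan (c * sin theta / (1 + c * cos theta))) / (1 - c ^ 2)).
assert (hw : 0 < 1 - c ^ 2) by nra.
replace (2 * PI * / (1 - c ^ 2)) with (minus (A (2 * PI)) (A 0)).
- apply (is_RInt_derive (V := R_CompleteNormedModule)).
  + intros x _. unfold A. pose proof (one_add_cos_pos c x hc) as h.
    pose proof (pden_pos c x hc) as hp.
    auto_derive; [lra|].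
    pose proof (sin2_cos2 x) as hs. rewrite !Rsqr_pow2 in hs. unfold pden in *.
    assert (hd : (1 + c * cos x) ^ 2 + (c * sin x) ^ 2 = 1 + 2 * c * cos x + c ^ 2).
    { rewrite Rpow_mult_distr. replace (sin x ^ 2) with (1 - cos x ^ 2) by lra. ring. }
    field_simplify_eq; [| repeat split; try lra; nra].
    replace (sin x ^ 2) with (1 - cos x ^ 2) by lra. ring.
  + intros x _. apply (ex_derive_continuous (fun theta => / pden c theta)).
    pose proof (pden_pos c x hc) as hp. unfold pden in *. auto_derive. lra.
- unfold A, minus, plus, opp; simpl. rewrite sin_2PI, cos_2PI, sin_0, cos_0.
  unfold Rdiv; rewrite !Rmult_0_r, !Rmult_0_l, atan_0. field. lra.
Qed.

(** The function [sin theta / D^(j+1)] has the same value at [0] and [2 PI], so its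
    derivative has integral zero.  As [2 c cos theta = D - (1 + c^2)], that
    derivative is, up to the factor [2 c], a combination of [D^(-j)], [D^(-j-1)]
    and [D^(-j-2)]; the recursion is the one of the Legendre polynomials. *)
Lemma pden_moment_step (c a b : R) (j : nat) : -1 < c < 1 ->
  is_RInt (fun theta => / pden c theta ^ j) 0 (2 * PI) a ->
  is_RInt (fun theta => / pden c theta ^ S j) 0 (2 * PI) b ->
  is_RInt (fun theta => / pden c theta ^ S (S j)) 0 (2 * PI)
    (((2 * INR j + 1) * (1 + c ^ 2) * b - INR j * a) / ((INR j + 1) * (1 - c ^ 2) ^ 2)).
Proof.
intros hc ha hb.
assert (hw : 0 < 1 - c ^ 2) by nra.
pose proof (pos_INR j) as hj.
set (B := fun theta => sin theta * / pden c theta ^ S j).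
set (dB := fun theta => cos theta * / pden c theta ^ S j
    + (INR j + 1) * (2 * c * (1 - cos theta ^ 2)) * / pden c theta ^ S (S j)).
assert (hB : is_RInt dB 0 (2 * PI) 0).
{ replace 0 with (minus (B (2 * PI)) (B 0)) at 2
    by (unfold B, minus, plus, opp; simpl; rewrite sin_2PI, sin_0; ring).
  apply (is_RInt_derive (V := R_CompleteNormedModule)).
  - intros x _. pose proof (pden_pos c x hc) as hp.
    assert (hpd : is_derive (pden c) x (- 2 * c * sin x))
      by (unfold pden; auto_derive; [exact I | ring]).
    unfold B, dB. evar_last.
    + apply (is_derive_mult sin (fun t => / pden c t ^ S j)); [apply is_derive_sin| |apply Rmult_comm].
      apply is_derive_inv; [|apply pow_nonzero; lra].
      apply is_derive_pow. exact hpd.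
    + unfold plus, mult; simpl pred. rewrite S_INR. simpl.
      pose proof (sin2_cos2 x) as hs. rewrite !Rsqr_pow2 in hs.
      replace (1 - cos x * (cos x * 1)) with (sin x ^ 2) by lra.
      assert (pden c x ^ j <> 0) by (apply pow_nonzero; lra).
      field. split; lra.
  - intros x _. apply (ex_derive_continuous dB).
    pose proof (pden_pos c x hc) as hp. unfold dB.
    assert (h1 : forall n, pden c x ^ n <> 0) by (intros; apply pow_nonzero; lra).
    unfold pden in *. auto_derive. repeat split; try apply (h1 (S j)); try apply (h1 (S (S j))). }
pose proof (is_RInt_lincomb _ _ _ _ _ _ ((2 * INR j + 1) * (1 + c ^ 2)) (- INR j) hb ha) as h1.
pose proof (is_RInt_lincomb _ _ _ _ _ _ 1 (- (2 * c)) h1 hB) as h2.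
pose proof (is_RInt_lincomb _ _ _ _ _ _ (/ ((INR j + 1) * (1 - c ^ 2) ^ 2)) 0 h2 hB) as h3.
evar_last; [eapply is_RInt_ext; [|exact h3]|].
- intros x _. pose proof (pden_pos c x hc) as hp. unfold dB. simpl.
  assert (pden c x ^ j <> 0) by (apply pow_nonzero; lra).
  field_simplify_eq; [|repeat split; lra]. unfold pden. ring.
- simpl. field. split; lra.
Qed.

Lemma cos_RInt : is_RInt cos 0 (2 * PI) 0.
Proof.
replace 0 with (minus (sin (2 * PI)) (sin 0)) at 2
  by (unfold minus, plus, opp; simpl; rewrite sin_2PI, sin_0; ring).
apply (is_RInt_derive (V := R_CompleteNormedModule)).
- intros x _. apply is_derive_sin.
- intros x _. apply continuous_cos.
Qed.

Lemma const_RInt (a : R) : is_RInt (fun _ : R => a) 0 (2 * PI) (2 * PI * a).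
Proof.
evar_last; [apply (is_RInt_const (V := R_NormedModule))|].
unfold scal; simpl; unfold mult; simpl; ring.
Qed.

Lemma pden_laurent_RInt (c t0 t1 t2 t3 t4 t5 : R) : -1 < c < 1 ->
  is_RInt (fun theta => t0 * pden c theta + t1 + t2 / pden c theta + t3 / pden c theta ^ 2
                 + t4 / pden c theta ^ 3 + t5 / pden c theta ^ 4) 0 (2 * PI)
  (2 * PI * (t0 * (1 + c ^ 2) + t1 + t2 / (1 - c ^ 2) + t3 * (1 + c ^ 2) / (1 - c ^ 2) ^ 3
     + t4 * (1 + 4 * c ^ 2 + c ^ 4) / (1 - c ^ 2) ^ 5
     + t5 * ((1 + c ^ 2) * (1 + 8 * c ^ 2 + c ^ 4)) / (1 - c ^ 2) ^ 7)).
Proof.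
intros hc.
assert (hw : 0 < 1 - c ^ 2) by nra.
assert (h0 : is_RInt (fun theta => / pden c theta ^ 0) 0 (2 * PI) (2 * PI)).
{ evar_last; [eapply is_RInt_ext; [|exact (const_RInt 1)]|].
  - intros x _; simpl; field.
  - ring. }
assert (h1 : is_RInt (fun theta => / pden c theta ^ 1) 0 (2 * PI) (2 * PI * / (1 - c ^ 2))).
{ eapply is_RInt_ext; [|exact (pden_moment1 c hc)]. intros x _. simpl. rewrite Rmult_1_r. reflexivity. }
pose proof (pden_moment_step c _ _ 0 hc h0 h1) as h2.
pose proof (pden_moment_step c _ _ 1 hc h1 h2) as h3.
pose proof (pden_moment_step c _ _ 2 hc h2 h3) as h4.
pose proof (is_RInt_lincomb _ _ _ _ _ _ (2 * c * t0) 1 cos_RInt (const_RInt (t0 * (1 + c ^ 2) + t1))) as k1.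
pose proof (is_RInt_lincomb _ _ _ _ _ _ t2 t3 h1 h2) as k2.
pose proof (is_RInt_lincomb _ _ _ _ _ _ t4 t5 h3 h4) as k3.
pose proof (is_RInt_lincomb _ _ _ _ _ _ 1 1 k1 k2) as k4.
pose proof (is_RInt_lincomb _ _ _ _ _ _ 1 1 k4 k3) as k5.
evar_last; [eapply is_RInt_ext; [|exact k5]|].
- intros x _. pose proof (pden_pos c x hc) as hp. simpl.
  field_simplify_eq; [|lra]. unfold pden. ring.
- simpl. field. lra.
Qed.

(** * The boundary integrand *)

Lemma Cmod_polar (r theta : R) : Cmod (polar r theta) = Rabs r.
Proof.
rewrite <- (Rabs_pos_eq (Cmod _)) by apply Cmod_ge_0.
apply Rsqr_eq_abs_0. rewrite !Rsqr_pow2, Cmod2_alt. unfold polar. simpl.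
pose proof (sin2_cos2 theta) as hs. unfold Rsqr in hs.
transitivity (r ^ 2 * (sin theta * sin theta + cos theta * cos theta)); [ring|].
rewrite hs. ring.
Qed.

Lemma Cmod_affine_polar (c r theta : R) :
  Cmod (1 + c * polar r theta)%C ^ 2 = 1 + 2 * c * r * cos theta + c ^ 2 * r ^ 2.
Proof.
rewrite Cmod2_alt. unfold polar. simpl.
pose proof (sin2_cos2 theta) as hs. unfold Rsqr in hs.
replace (sin theta * sin theta) with (1 - cos theta * cos theta) in hs by lra.
ring_simplify. replace (sin theta ^ 2) with (1 - cos theta ^ 2)
  by (pose proof (sin2_cos2 theta) as h; unfold Rsqr in h; lra). ring.
Qed.

(** [|g + 2 lam z + g lam^2 z^2|^2] for [z = r exp(i theta)] and [x = cos theta],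
    the numerator of [|F'|^2]. *)
Definition Fprime_num (g lam r x : R) : R :=
  g ^ 2 + 4 * lam ^ 2 * r ^ 2 + (g * lam ^ 2) ^ 2 * r ^ 4 + 4 * g * lam * r * x
  + 4 * g * lam ^ 3 * r ^ 3 * x + 2 * g ^ 2 * lam ^ 2 * r ^ 2 * (2 * x ^ 2 - 1).

Lemma Cmod_zderiv_Fgl (g lam r theta : R) : Rabs (g * lam) * Cmod (polar r theta) < 1 ->
  Cmod (zderiv (Fgl g lam) (polar r theta)) ^ 2 =
  r ^ 2 * Fprime_num g lam r (cos theta)
    / (1 + 2 * (g * lam) * r * cos theta + (g * lam) ^ 2 * r ^ 2) ^ 2.
Proof.
intros h.
assert (hd : (1 + g * lam * polar r theta)%C <> 0%C).
{ rewrite <- RtoC_mult. apply denom_neq0, h. }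
unfold zderiv. rewrite Fgl_C_derive by exact hd.
rewrite Cmod_mult, Cmod_div, Cmod_pow by (apply Cpow_nz; exact hd).
rewrite <- Cmod_affine_polar, RtoC_mult. apply Cmod_gt_0 in hd.
set (m := Cmod (1 + g * lam * polar r theta)%C) in *.
replace (r ^ 2) with (Cmod (polar r theta) ^ 2).
replace (Fprime_num g lam r (cos theta)) with
  (Cmod (g + 2 * lam * polar r theta + g * lam * lam * polar r theta ^ 2)%C ^ 2).
- field. lra.
- rewrite Cmod2_alt. unfold polar, Fprime_num. simpl.
  pose proof (sin2_cos2 theta) as hs. unfold Rsqr in hs.
  set (C := cos theta) in *. set (S := sin theta) in *.
  ring_simplify.
  replace (S ^ 4) with ((1 - C ^ 2) ^ 2) by (replace (1 - C ^ 2) with (S ^ 2) by lra; ring).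
  replace (S ^ 2) with (1 - C ^ 2) by lra. ring.
- rewrite Cmod_polar. apply pow2_abs.
Qed.

(** With [N] the numerator [Fprime_num] and [D] the denominator on the circle of radius
    [r], the radial derivative of [r^2 N / D^2] at [r = 1] is
    [(2 N + N') / D^2 - 2 N D' / D^3].  There [D' = D - (1 - c^2)], which turns it
    into [(N' D + 2 (1 - c^2) N) / D^3].  This is the numerator of that fraction.
    Since [4 g lam x = 2 (D - (1 + c^2))], it is a polynomial in [D] whose
    coefficients have no denominators. *)
Definition radial_num (g lam D : R) : R :=
  let c := g * lam in let s := 1 + c ^ 2 in
  (8 * lam ^ 2 + 4 * c ^ 2 * lam ^ 2 - 4 * c ^ 2 + 2 * (1 + 3 * lam ^ 2) * (D - s) + 2 * (D - s) ^ 2) * D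
  + 2 * (1 - c ^ 2) * (g ^ 2 + 4 * lam ^ 2 + c ^ 2 * lam ^ 2 - 2 * c ^ 2 + 2 * (1 + lam ^ 2) * (D - s) + (D - s) ^ 2).

Lemma Derive_Cmod_zderiv_Fgl (g lam theta : R) : -1 < g < 1 -> -1 <= lam <= 1 ->
  Derive (fun r => Cmod (zderiv (Fgl g lam) (polar r theta)) ^ 2) 1 =
  radial_num g lam (pden (g * lam) theta) / pden (g * lam) theta ^ 3.
Proof.
intros hg hl. pose proof (Rabs_glam g lam hg hl) as hc.
assert (hc' : -1 < g * lam < 1) by (apply Rabs_def2 in hc; lra).
pose proof (pden_pos _ theta hc') as hp.
pose proof (Rabs_pos (g * lam)) as hc0.
assert (he : 0 < 1 - Rabs (g * lam)) by lra.
rewrite (Derive_ext_loc _ (fun r => r ^ 2 * Fprime_num g lam r (cos theta)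
    / (1 + 2 * (g * lam) * r * cos theta + (g * lam) ^ 2 * r ^ 2) ^ 2)).
- apply is_derive_unique. unfold Fprime_num, radial_num, pden in *. auto_derive.
  + replace (1 + 2 * (g * lam) * 1 * cos theta + (g * lam) ^ 2 * 1 ^ 2) with
    (1 + 2 * (g * lam) * cos theta + (g * lam) ^ 2) by ring.
    nra.
  + field_simplify_eq; [ring|lra].
- exists (mkposreal _ he). intros r hr. apply Cmod_zderiv_Fgl. rewrite Cmod_polar.
  assert (Rabs r < 1 + (1 - Rabs (g * lam))).
  { replace r with (1 + (r - 1)) by ring.
    pose proof (Rabs_triang 1 (r - 1)). rewrite Rabs_R1 in *.
    change (Rabs (r - 1) < 1 - Rabs (g * lam)) in hr. lra. }
  nra.
Qed.

Lemma one_sub_Re_Fgl (g lam theta : R) : -1 < g < 1 -> -1 <= lam <= 1 ->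
  1 - Re (Fgl g lam (polar 1 theta)) =
  (pden (g * lam) theta - g ^ 2 * lam + lam - (g + g * lam ^ 2) * cos theta
    - 2 * lam * cos theta ^ 2) / pden (g * lam) theta.
Proof.
intros hg hl. pose proof (Rabs_glam g lam hg hl) as hc.
assert (hc' : -1 < g * lam < 1) by (apply Rabs_def2 in hc; lra).
pose proof (pden_pos _ theta hc') as hp.
pose proof (sin2_cos2 theta) as hs. unfold Rsqr in hs.
unfold Fgl, polar, pden in *. simpl.
set (C := cos theta) in *. set (S := sin theta) in *.
assert (hS : S ^ 2 = 1 - C ^ 2) by lra.
assert (hd : 1 + 2 * (g * lam) * C + (g * lam) ^ 2 = (1 + g * lam * C) ^ 2 + (g * lam) ^ 2 * S ^ 2) by (rewrite hS; ring).
field_simplify_eq; [ | repeat split; nra ].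
replace (S ^ 4) with ((S ^ 2) ^ 2) by ring. rewrite hS. ring.
Qed.

(** * Evaluation of the functional *)

(** Cubics that collect the moments of the integrand; in powers of
    [w = 1 - (g lam)^2] all their coefficients are nonnegative. *)
Definition polyA (w : R) := 6 + w ^ 2 + w ^ 3.

Definition polyK (w : R) := 6 + 4 * w + 5 * w ^ 2 + 6 * w ^ 3.

Definition polyE (w : R) := 10 + 6 * w + 5 * w ^ 2 + 3 * w ^ 3.

(** The value of the functional on the family; see [Rfun_Fgl]. *)
Definition Rclosed (g lam : R) : R :=
  let w := 1 - (g * lam) ^ 2 in
  let d := 1 - g ^ 2 in
  g ^ 2 * (1 - 3 * (lam * d)) +
  (lam * d) ^ 2 * (w * (polyA w + lam * g ^ 2 * polyK w) - (g * lam) ^ 2 * d * lam * polyE w) / w ^ 5.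

(** When [g lam <> 0], [cos theta] is eliminated in favour of [D], and the integrand
    becomes a Laurent polynomial in [D] with the coefficients of the product of
    [1 - Re F] (the [a_i]) and of the radial derivative (the [b_i]).  When
    [g lam = 0], [D = 1] and the integrand is a quadratic in [cos theta]. *)
Lemma integrand_RInt (g lam : R) : -1 < g < 1 -> -1 <= lam <= 1 ->
  is_RInt (fun theta =>
    (pden (g * lam) theta - g ^ 2 * lam + lam - (g + g * lam ^ 2) * cos theta
    - 2 * lam * cos theta ^ 2) / pden (g * lam) theta
    * (radial_num g lam (pden (g * lam) theta) / pden (g * lam) theta ^ 3)) 0 (2 * PI) (4 * PI * Rclosed g lam).
Proof.
intros hg hl. pose proof (Rabs_glam g lam hg hl) as hc.
assert (hc' : -1 < g * lam < 1) by (apply Rabs_def2 in hc; lra).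
assert (hw : 0 < 1 - (g * lam) ^ 2) by nra.
destruct (Req_dec (g * lam) 0) as [h0|h0].
- assert (hcos2 : is_RInt (fun t => 1 - 2 * cos t ^ 2) 0 (2 * PI) 0).
  { replace 0 with (minus ((- (sin (2 * PI) * cos (2 * PI)))) (- (sin 0 * cos 0))) at 2
      by (unfold minus, plus, opp; simpl; rewrite sin_2PI, sin_0; ring).
    apply (is_RInt_derive (V := R_CompleteNormedModule) (fun t => - (sin t * cos t))).
    - intros x _. auto_derive; [exact I|].
      pose proof (sin2_cos2 x) as hs. unfold Rsqr in hs. lra.
    - intros x _. apply (ex_derive_continuous (fun t => 1 - 2 * cos t ^ 2)). auto_derive. exact I. }
  pose proof (is_RInt_lincomb _ _ _ _ _ _ lam (- g) hcos2 cos_RInt) as h1.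
  pose proof (is_RInt_lincomb _ _ _ _ _ _ (2 * g ^ 2 + 16 * lam ^ 2) 1 h1
    (const_RInt (2 * g ^ 2 + 16 * lam ^ 2))) as h2.
  evar_last; [eapply is_RInt_ext; [|exact h2]|].
  + intros x _. unfold radial_num, pden. cbv zeta.
    apply Rmult_integral in h0. simpl. destruct h0; subst; field_simplify_eq.
    all: try lra; try ring.
  + unfold Rclosed, polyA, polyK, polyE. rewrite h0.
    apply Rmult_integral in h0. destruct h0; subst; field.
- assert (hg0 : g <> 0) by (intros ->; apply h0; ring).
  assert (hl0 : lam <> 0) by (intros ->; apply h0; ring).
  set (s := 1 + (g * lam) ^ 2). set (w := 1 - (g * lam) ^ 2) in *.
  set (a2 := - / (2 * g ^ 2 * lam)).
  set (a1 := 1 - (1 + lam ^ 2) / (2 * lam) + s / (g ^ 2 * lam)).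
  set (a0 := lam - g ^ 2 * lam + (1 + lam ^ 2) * s / (2 * lam) - s ^ 2 / (2 * g ^ 2 * lam)).
  set (b2 := 2 * (1 + 3 * lam ^ 2) - 4 * s + 2 * w).
  set (b1 := 8 * lam ^ 2 + 4 * (g * lam) ^ 2 * lam ^ 2 - 4 * (g * lam) ^ 2 - 2 * (1 + 3 * lam ^ 2) * s
     + 2 * s ^ 2 + 2 * w * (2 * (1 + lam ^ 2) - 2 * s)).
  set (b0 := 2 * w * (g ^ 2 + 4 * lam ^ 2 + (g * lam) ^ 2 * lam ^ 2 - 2 * (g * lam) ^ 2
     - 2 * (1 + lam ^ 2) * s + s ^ 2)).
  pose proof (pden_laurent_RInt (g * lam) (a2 * 2) (a2 * b2 + a1 * 2) (a2 * b1 + a1 * b2 + a0 * 2)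
    (a2 * b0 + a1 * b1 + a0 * b2) (a1 * b0 + a0 * b1) (a0 * b0) hc') as h1.
  evar_last; [eapply is_RInt_ext; [|exact h1]|].
  + intros x _. pose proof (pden_pos _ x hc') as hp.
    assert (hA : pden (g * lam) x - g ^ 2 * lam + lam - (g + g * lam ^ 2) * cos x
      - 2 * lam * cos x ^ 2 = a0 + a1 * pden (g * lam) x + a2 * pden (g * lam) x ^ 2).
    { unfold a0, a1, a2, s, pden. field. split; assumption. }
    assert (hB : radial_num g lam (pden (g * lam) x) = b0 + b1 * pden (g * lam) x
      + b2 * pden (g * lam) x ^ 2 + 2 * pden (g * lam) x ^ 3).
    { unfold radial_num, b0, b1, b2, s, w. ring. }
    cbv beta. rewrite hA, hB. simpl. field. lra.
  + unfold Rclosed, polyA, polyK, polyE. unfold a0, a1, a2, b0, b1, b2, s, w in *. simpl. field.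
    repeat split; try assumption. lra.
Qed.

Lemma Rfun_Fgl (g lam : R) : -1 < g < 1 -> -1 <= lam <= 1 -> Rfun (Fgl g lam) = Rclosed g lam.
Proof.
intros hg hl. unfold Rfun, Rfun_at.
rewrite (is_RInt_unique _ _ _ (4 * PI * Rclosed g lam)).
- field. apply PI_neq0.
- eapply is_RInt_ext; [|exact (integrand_RInt g lam hg hl)].
  intros x _. cbv beta. rewrite one_sub_Re_Fgl, Derive_Cmod_zderiv_Fgl by assumption. reflexivity.
Qed.

(** * Positivity of the closed form *)

(** For fixed [w] and [d >= 0] the sum [10 d^3 - 8 w^2 d^2] is minimal at [d = (8/15) w^2], where
    it equals [- (512/675) w^6]. *)
Lemma cubic_pos (w d : R) : 0 < w <= 1 -> 0 <= d ->
  0 < w ^ 5 + 10 * d ^ 3 - 8 * w ^ 2 * d ^ 2.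
Proof.
intros hw hd.
replace (w ^ 5 + 10 * d ^ 3 - 8 * w ^ 2 * d ^ 2) with
  (w ^ 5 * (1 - 512 / 675 * w) + 10 * (d - 8 / 15 * w ^ 2) ^ 2 * (d + 4 / 15 * w ^ 2)) by field.
assert (0 < w ^ 5) by (apply pow_lt; lra).
assert (0 <= (d - 8 / 15 * w ^ 2) ^ 2 * (d + 4 / 15 * w ^ 2)).
{ apply Rmult_le_pos; [apply pow2_ge_0 | nra]. }
nra.
Qed.

(** This polynomial is [l A - m^2 K + 8 m^2 l (1 - l)] at the endpoint [l = m] of
    [concave_lower_bound], divided by [m (1 - m)]. *)
Lemma edge_pos (m : R) : 0 <= m <= 1 ->
  0 <= 8 - 13 * m - 10 * m ^ 2 + 14 * m ^ 3 + 18 * m ^ 4 - 5 * m ^ 5 - 6 * m ^ 6.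
Proof.
intros hm.
(* On [[0, 1]] the two top terms are at least [- 11 m^4]. *)
assert (0 <= m^4 * (11 - 5 * m - 6 * m ^ 2)).
{ apply Rmult_le_pos; [apply pow_le; lra | nra]. }
assert (0 <= 8 - 13 * m - 10 * m ^ 2 + 14 * m ^ 3 + 7 * m ^ 4).
(* The remaining quartic has its minimum on [[0, 1]], about 0.42, near [m = 0.65]; the two
   squares below vanish close to that point. *)
{ assert (0 <= (m - 65 / 100) ^ 2 * (m + 1)) by (apply Rmult_le_pos; [apply pow2_ge_0 | lra]).
  pose proof (pow2_ge_0 (m ^ 2 - 43 / 100)). nra. }
nra.
Qed.

(** For fixed [m] the right-hand side is a concave quadratic in [l].  It is
    nonnegative at [l = m] by [edge_pos] and at [l = 1], where it equals
    [2 w + 6 w^4] with [w = 1 - m^2].  The proof writes it as the interpolation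
    between these two values plus [8 m^2 (l - m) (1 - l)]. *)
Lemma concave_lower_bound (m l : R) : 0 <= m <= l -> l <= 1 ->
  0 <= l * polyA (1 - m ^ 2) - m ^ 2 * polyK (1 - m ^ 2) + 8 * m ^ 2 * l * (1 - l).
Proof.
intros hm hl.
replace (l * polyA (1 - m ^ 2) - m ^ 2 * polyK (1 - m ^ 2) + 8 * m ^ 2 * l * (1 - l)) with
 ((1 - l) * (m * (8 - 13 * m - 10 * m ^ 2 + 14 * m ^ 3 + 18 * m ^ 4 - 5 * m ^ 5 - 6 * m ^ 6))
  + (l - m) * ((1 + m) * (2 + 6 * (1 - m ^ 2) ^ 3)) + 8 * m ^ 2 * ((l - m) * (1 - l)))
 by (unfold polyA, polyK; ring).
assert (0 <= (1 - m ^ 2) ^ 3) by (apply pow_le; nra).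
repeat apply Rplus_le_le_0_compat; repeat apply Rmult_le_pos; try lra; try nra.
apply edge_pos; lra.
Qed.

(** A discriminant argument: as a quadratic in [y = lam (1 - g^2)], the value is at
    least [u (1 - 3 y) + (B / w^4) y^2], which has no real zero with [u > 0] because
    [B / w^4 > (9/4) u]; if [u = 0], only [y = 0] would make it vanish. *)
Lemma Rclosed_pos_nneg (g lam : R) : -1 < g < 1 -> 0 <= lam <= 1 -> g <> 0 \/ lam <> 0 ->
  0 < Rclosed g lam.
Proof.
intros hg hl hne.
assert (hu : 0 <= g ^ 2 < 1) by nra.
assert (ht : 0 <= (g * lam) ^ 2 <= g ^ 2).
{ rewrite Rpow_mult_distr. assert (0 <= lam ^ 2 <= 1) by nra. nra. }
unfold Rclosed.
set (u := g ^ 2) in *. set (t := (g * lam) ^ 2) in *.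
assert (htu : t = u * lam ^ 2) by (unfold t, u; ring).
set (w := 1 - t). set (d := 1 - u).
assert (hw : 0 < w <= 1) by (unfold w; lra).
assert (hd : 0 < d <= w) by (unfold d, w; lra).
set (y := lam * d).
(* [w B] is what remains of the bracket after [t d lam <= t w] and [t <= lam u]. *)
set (B := polyA w - t * (polyE w - polyK w)).
assert (hB : 2 + 9 / 4 * w ^ 4 <= B).
{ assert (0 <= w ^ 3 * (1 - w)) by (apply Rmult_le_pos; [apply pow_le|]; lra).
  unfold B. replace t with (1 - w) by (unfold w; ring). unfold polyA, polyK, polyE.
  assert (0 <= w^3) by (apply pow_le; lra). nra. }
assert (hk : 0 <= polyK w) by (unfold polyK; nra).
assert (he : 0 <= polyE w) by (unfold polyE; nra).
assert (hbr : w * B <= w * (polyA w + lam * u * polyK w) - t * d * lam * polyE w).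
{ assert (t * d * lam * polyE w <= w * (t * polyE w)).
  { replace (t * d * lam * polyE w) with (t * polyE w * (d * lam)) by ring.
    replace (w * (t * polyE w)) with (t * polyE w * w) by ring.
    apply Rmult_le_compat_l; [apply Rmult_le_pos; lra | nra]. }
  assert (t * polyK w <= lam * u * polyK w) by (apply Rmult_le_compat_r; nra).
  unfold B; nra. }
assert (hw4 : 0 < w ^ 4) by (apply pow_lt; lra).
apply Rlt_le_trans with (u * (1 - 3 * y) + y ^ 2 * (B / w ^ 4)).
- replace (u * (1 - 3 * y) + y ^ 2 * (B / w ^ 4)) with
    (u * (1 - 3 / 2 * y) ^ 2 + y ^ 2 * ((B - 9 / 4 * u * w ^ 4) / w ^ 4)) by (field; lra).
  assert (hq : 0 < (B - 9 / 4 * u * w ^ 4) / w ^ 4) by (apply Rdiv_lt_0_compat; nra).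
  destruct (Req_dec lam 0) as [h0|h0].
  + assert (0 < u) by (unfold u; destruct hne; [rewrite <- Rsqr_pow2; apply Rlt_0_sqr; assumption | lra]).
    unfold y; rewrite h0; nra.
  + assert (0 < y) by (unfold y; apply Rmult_lt_0_compat; lra).
    assert (0 < y ^ 2 * ((B - 9 / 4 * u * w ^ 4) / w ^ 4)) by (apply Rmult_lt_0_compat; nra).
    pose proof (pow2_ge_0 (1 - 3 / 2 * y)). nra.
- apply Rplus_le_compat_l. unfold Rdiv. rewrite Rmult_assoc.
  apply Rmult_le_compat_l; [apply pow2_ge_0|].
  replace (B * / w ^ 4) with (w * B * / w ^ 5) by (field; lra).
  apply Rmult_le_compat_r; [|exact hbr].
  apply Rlt_le, Rinv_0_lt_compat, pow_lt; lra.
Qed.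

(** The summand with [polyK] is the only one that can be negative.  Its loss is
    measured by [concave_lower_bound] and absorbed by the other two through
    [cubic_pos], which needs [g <> 0]; for [g = 0] there is no loss. *)
Lemma Rclosed_pos_neg (g lam : R) : -1 < g < 1 -> -1 <= lam < 0 -> 0 < Rclosed g lam.
Proof.
intros hg hlam.
set (l := - lam).
assert (hl : 0 < l <= 1) by (unfold l; lra).
assert (hu : 0 <= g ^ 2 < 1) by nra.
set (m := Rabs g * l).
assert (hm : 0 <= m <= l).
{ unfold m. assert (Rabs g < 1) by (apply Rabs_def1; lra). pose proof (Rabs_pos g). nra. }
assert (hm2 : m ^ 2 = g ^ 2 * l ^ 2).
{ unfold m. rewrite Rpow_mult_distr, pow2_abs. ring. }
pose proof (concave_lower_bound m l hm (proj2 hl)) as hmid.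
set (w := 1 - m ^ 2) in *. set (u := g ^ 2) in *. set (d := 1 - u).
assert (hml : m < 1) by (unfold m; assert (Rabs g < 1) by (apply Rabs_def1; lra);
  pose proof (Rabs_pos g); nra).
assert (hw : 0 < w <= 1) by (unfold w; split; nra).
assert (hd : 0 < d <= 1) by (unfold d; lra).
assert (h1l : 1 - l <= w) by (unfold w; nra).
assert (hw5 : 0 < w ^ 5) by (apply pow_lt; lra).
set (D := l ^ 2 * d).
assert (hD : 0 < D) by (apply Rmult_lt_0_compat; nra).
set (S := u * w ^ 5 * (1 + 3 * l * d) + l * d ^ 2 * w * (l * polyA w - m ^ 2 * polyK w)
   + l ^ 3 * m ^ 2 * d ^ 3 * polyE w).
assert (hR : Rclosed g lam = S / w ^ 5).
{ unfold Rclosed, S. replace (g * lam) with (- (g * l)) by (unfold l; ring).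
  replace ((- (g * l)) ^ 2) with (m ^ 2) by (rewrite hm2; unfold u; ring).
  replace lam with (- l) by (unfold l; ring). fold u. fold w. fold d.
  replace (l * polyA w - m ^ 2 * polyK w) with (l * (polyA w - l * u * polyK w)) by (rewrite hm2; ring).
  field. lra. }
rewrite hR. apply Rdiv_lt_0_compat; [|exact hw5].
destruct (Req_dec u 0) as [h0|h0].
- assert (hm0 : m ^ 2 = 0) by (rewrite hm2, h0; ring).
  assert (hw1 : w = 1) by (unfold w; lra).
  assert (hd1 : d = 1) by (unfold d; lra).
  unfold S, polyA. rewrite h0, hm0, hw1, hd1. nra.
- assert (hu0 : 0 < u) by lra.
  apply Rlt_le_trans with (u * (w ^ 5 + 10 * D ^ 3 - 8 * w ^ 2 * D ^ 2)).
  { apply Rmult_lt_0_compat; [exact hu0 | apply cubic_pos; lra]. }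
  assert (hA : u * w ^ 5 <= u * w ^ 5 * (1 + 3 * l * d)).
  { assert (0 < u * w ^ 5) by (apply Rmult_lt_0_compat; lra).
    assert (0 <= l * d) by nra. nra. }
  assert (hB : - (u * (8 * w ^ 2 * D ^ 2)) <=
               l * d ^ 2 * w * (l * polyA w - m ^ 2 * polyK w)).
  { assert (hp : 0 <= l * d ^ 2 * w) by (repeat apply Rmult_le_pos; nra).
    assert (0 <= l * d ^ 2 * w * (8 * m ^ 2 * l) * (w - (1 - l))).
    { apply Rmult_le_pos; [apply Rmult_le_pos|]; nra. }
    assert (0 <= l * d ^ 2 * w * (l * polyA w - m ^ 2 * polyK w + 8 * m ^ 2 * l * (1 - l))).
    { apply Rmult_le_pos; [exact hp | exact hmid]. }
    replace (u * (8 * w ^ 2 * D ^ 2)) with (l * d ^ 2 * w * (8 * m ^ 2 * l) * w)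
      by (rewrite hm2; unfold D; ring).
    nra. }
  assert (hC : u * (10 * D ^ 3) <= l ^ 3 * m ^ 2 * d ^ 3 * polyE w).
  { replace (u * (10 * D ^ 3)) with (u * (l ^ 5 * d ^ 3) * (10 * l)) by (unfold D; ring).
    replace (l ^ 3 * m ^ 2 * d ^ 3 * polyE w) with (u * (l ^ 5 * d ^ 3) * polyE w)
      by (rewrite hm2; ring).
    apply Rmult_le_compat_l.
    - apply Rmult_le_pos; [lra | apply Rmult_le_pos; apply pow_le; lra].
    - unfold polyE. assert (0 <= w ^ 3) by (apply pow_le; lra). nra. }
  unfold S. lra.
Qed.

Lemma Rclosed_0 : Rclosed 0 0 = 0.
Proof. unfold Rclosed. field. Qed.

Theorem theorem3p17 (g lam : R) (hg : -1 < g < 1) (hlam : -1 <= lam <= 1) :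
  schur (Fgl g lam) /\
  Fgl g lam (RtoC 0) = RtoC 0 /\
  analytic_near_closed_disk (Fgl g lam) /\
  0 <= Rfun (Fgl g lam) /\
  (Rfun (Fgl g lam) = 0 <-> g = 0 /\ lam = 0) /\
  (g = 0 /\ lam = 0 -> forall z : C, Fgl g lam z = RtoC 0) /\
  ((exists z : C, Cmod z < 1 /\ Fgl g lam z <> RtoC 0) -> 0 < Rfun (Fgl g lam)).
Proof.
assert (hpos : g <> 0 \/ lam <> 0 -> 0 < Rclosed g lam).
{ intros hne. destruct (Rle_dec 0 lam).
  - apply Rclosed_pos_nneg; auto; lra.
  - apply Rclosed_pos_neg; lra. }
assert (hzero : g = 0 /\ lam = 0 -> forall z : C, Fgl g lam z = RtoC 0).
{ intros [-> ->] z. unfold Fgl.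
  replace (1 + 0 * 0 * z)%C with (RtoC 1) by ring. field. }
assert (hcase : (g = 0 /\ lam = 0) \/ (g <> 0 \/ lam <> 0)) by lra.
rewrite (Rfun_Fgl g lam hg hlam).
repeat split.
- apply Fgl_schur; assumption.
- apply Fgl_schur; assumption.
- unfold Fgl. apply Cmult_0_l.
- apply Fgl_near_disk; assumption.
- destruct hcase as [[-> ->]|hne]; [rewrite Rclosed_0; lra | apply Rlt_le, hpos, hne].
- destruct hcase as [[h _]|hne]; [exact h | apply hpos in hne; lra].
- destruct hcase as [[_ h]|hne]; [exact h | apply hpos in hne; lra].
- intros [-> ->]. apply Rclosed_0.
- exact hzero.
- intros [z [_ hz]]. destruct hcase as [h|hne]; [|apply hpos, hne].
  destruct hz. apply hzero, h.
Qed.
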